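(* Let $T$ be an $n\times n$ positive matrix. Then $T$ is irreducible and primitive if and only if the wedge operator $W_T$ on $M_n(\mathbb C)$ is irreducible.
   Context: $M_n(\mathbb C)$ is the algebra of $n\times n$ complex matrices with the entrywise order (a matrix is positive if all its entries are real and $\ge0$), viewed also as a Banach lattice $\cong\mathbb C^{n\times n}$ with the entrywise (coordinatewise) order. The wedge operator is $W_TS=TST$, $S\in M_n(\mathbb C)$. A positive matrix (on $\mathbb C^n$), or more generally a positive operator on a finite-dimensional coordinate lattice, is irreducible if it leaves no band invariant other than $\{0\}$ and the whole space; here bands are the subspaces of vectors supported on a given subset of the coordinates (for $M_n(\mathbb C)$: matrices supported on a given subset of the entries). The zero $1\times1$ matrix is irreducible. A matrix $T$ is primitive if its peripheral spectrum $\{\lambda\in\sigma(T):|\lambda|=r(T)\}$ contains at most one point, $r(T)$ being the spectral radius. *)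

(* Defs.v *)
From HB Require Import structures.
From mathcomp Require Import all_boot all_order all_algebra.
From mathcomp Require Import all_classical all_reals.
From mathcomp.real_closed Require Export complex.

Set Implicit Arguments.
Unset Strict Implicit.
Unset Printing Implicit Defensive.

Import Order.TTheory GRing.Theory Num.Theory.
Import ComplexField.Normc.

Local Open Scope classical_set_scope.
Local Open Scope ring_scope.

(* The order of R[i] has 0 <= z exactly when z is real and nonnegative. *)
Definition positive_mx (R : realType) (m p : nat) (A : 'M[R[i]]_(m, p)) : Prop :=
  forall i j, 0 <= A i j.

Definition spectrum (R : realType) (n : nat) (T : 'M[R[i]]_n) : set R[i] :=
  [set a | a%:M - T \notin unitmx].

(* normc is the R-valued modulus; the norm `|a| of R[i] lives in R[i]. *)
Definition spectral_radius (R : realType) (n : nat) (T : 'M[R[i]]_n) : R :=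
  sup [set normc a | a in spectrum T].

Definition peripheral_spectrum (R : realType) (n : nat) (T : 'M[R[i]]_n) :
    set R[i] :=
  [set a | spectrum T a /\ normc a = spectral_radius T].

(* is_subset1 means "at most one point". *)
Definition primitive (R : realType) (n : nat) (T : 'M[R[i]]_n) : Prop :=
  is_subset1 (peripheral_spectrum T).

(* The coordinates of the lattice 'M_(m, p) are its entries; C^n is the case
   p = 1, 'cV_n being 'M_(n, 1). *)
Definition band (R : realType) (m p : nat) (J : {set 'I_m * 'I_p}) :
    set 'M[R[i]]_(m, p) :=
  [set S | forall i j, (i, j) \notin J -> S i j = 0].

Definition is_band (R : realType) (m p : nat) (B : set 'M[R[i]]_(m, p)) : Prop :=
  exists J : {set 'I_m * 'I_p}, B = band J.

Definition irreducible_op (R : realType) (m p : nat)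
    (L : 'M[R[i]]_(m, p) -> 'M[R[i]]_(m, p)) : Prop :=
  forall B : set 'M[R[i]]_(m, p),
    is_band B -> (forall x, B x -> B (L x)) -> B = [set 0] \/ B = setT.

Definition irreducible_mx (R : realType) (n : nat) (T : 'M[R[i]]_n) : Prop :=
  irreducible_op (fun x : 'cV[R[i]]_n => T *m x).

Definition wedge (R : realType) (n : nat) (T S : 'M[R[i]]_n) : 'M[R[i]]_n :=
  T *m S *m T.

(* Main.v *)
Require Import Defs.
From mathcomp Require Import all_boot all_order all_algebra.
From mathcomp Require Import all_classical all_reals.
From mathcomp Require Import topology normedtype derive.

(** Bands are sets of coordinates, so both irreducibility conditions speak only
    of the zero pattern of [T] ([irreducible_mxP], [wedge_irreducibleP]). Read
    [T i j != 0] as an edge from [j] to [i]. Then [T] is irreducible when this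
    graph is strongly connected, and [wedge T] is irreducible when pairs of
    coordinates are connected by moves in which the first one follows an edge
    forwards while the second follows an edge backwards.

    The link with the spectrum is the Perron eigenvalue [r] of an irreducible
    [T], with positive left and right eigenvectors [u] and [v] ([perron_row],
    by the maximization of Collatz and Wielandt over a compact set). Pairing
    with [v] shows that [r] bounds the modulus of all eigenvalues, so [r] is the
    spectral radius, and that [w T <= r w] implies [w T = r w]
    ([eq_row_pairing]).

    Suppose that [T] is irreducible and that [r > 0] is its only peripheral
    eigenvalue. An invariant set [J] of a power [T ^+ m] yields a nonnegative
    vector [w], supported off [J], with [w T^m = r^m w]. Since the [m]-th roots
    of [r^m] other than [r] are not eigenvalues, [w T = r w]
    ([eigenvector_of_power]), so [J] is invariant under [T] itself. Hence all
    powers of [T] are irreducible ([primitive_powers_irreducible]). This allows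
    walks of a common length between any two prescribed pairs of coordinates,
    which is the irreducibility of [wedge T] ([powers_irreducible_wedge]).

    Conversely, let [wedge T] be irreducible and let [z T = a z] with
    [`|a| = r]. Equality in the triangle inequality forces the phase of [z] to
    be multiplied by a fixed factor along each edge. The product of the phases
    at two coordinates is then constant along the moves of pairs described
    above, hence constant altogether, and the factor is 1, that is, [a = r]
    ([wedge_irreducible_peripheral]). *)

Set Implicit Arguments.
Unset Strict Implicit.
Unset Printing Implicit Defensive.

Import Order.TTheory GRing.Theory Num.Theory.
Import ComplexField.Normc.
Import numFieldNormedType.Exports.

Local Open Scope classical_set_scope.
Local Open Scope ring_scope.

(** * Invariant bands as sets of coordinates *)

Section Bands.
Variables (R : realType) (m p : nat).
Implicit Types J K : {set 'I_m * 'I_p}.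

Lemma band0 : band (R := R) (@finset.set0 ('I_m * 'I_p)%type) = [set 0].
Proof.
apply/seteqP; split=> [S S0 | S -> i j _]; last by rewrite mxE.
by apply/matrixP=> i j; rewrite S0 ?inE// mxE.
Qed.

Lemma bandT : band (R := R) [set: 'I_m * 'I_p]%SET = setT.
Proof. by apply/seteqP; split=> // S _ i j; rewrite inE. Qed.

Lemma delta_band J i j : band (R := R) J (delta_mx i j) <-> (i, j) \in J.
Proof.
split=> [dJ|ijJ k l klJ].
  apply/negPn/negP=> /dJ; rewrite mxE !eqxx; exact/eqP/oner_neq0.
by rewrite mxE; case: eqP klJ => [->|//]; case: eqP => // -> /negP.
Qed.

Lemma band_inj : injective (@band R m p).
Proof.
move=> J K JK; apply/setP=> -[i j]; apply/idP/idP=> /(delta_band _ i j).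
  by rewrite JK => /delta_band.
by rewrite -JK => /delta_band.
Qed.

(** A set of coordinates is empty or full exactly when it contains everything as
    soon as it contains something; in this form the empty set needs no separate
    treatment. *)
Lemma irreducible_opP (L : 'M[R[i]]_(m, p) -> 'M[R[i]]_(m, p)) :
  irreducible_op L <->
  forall J, (forall S, band J S -> band J (L S)) ->
    forall a b, a \in J -> b \in J.
Proof.
split=> [irrL J JL a b | irrL _ [J ->] JL].
  have [J0|JT _] := irrL (band J) (ex_intro _ J erefl) JL.
    by rewrite (_ : J = finset.set0) ?inE//; apply: band_inj; rewrite J0 band0.
  by rewrite (_ : J = [set: _]%SET) ?inE//; apply: band_inj; rewrite JT bandT.
have [J0|[a aJ]] := set_0Vmem J; first by left; rewrite J0 band0.
right; rewrite -bandT; congr band; apply/setP=> b.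
by rewrite inE (irrL J JL a b aJ).
Qed.

End Bands.

(** Invariance under [A] of the band of column vectors supported on [J]. *)
Definition stable (F : nmodType) n (A : 'M[F]_n) (J : {set 'I_n}) :=
  forall i j, j \in J -> i \notin J -> A i j = 0.

Definition pattern_irreducible (F : nmodType) n (A : 'M[F]_n) :=
  forall J, stable A J -> forall i j, i \in J -> j \in J.

(** Invariance of the band of [J] under [S |-> A *m S *m A]: the product below
    is the entry [(i, l)] of [A *m delta_mx j k *m A]. *)
Definition wedge_stable (F : pzRingType) n (A : 'M[F]_n)
    (J : {set 'I_n * 'I_n}) :=
  forall i j k l, (j, k) \in J -> (i, l) \notin J -> A i j * A k l = 0.

Lemma irreducible_mxP (R : realType) n (T : 'M[R[i]]_n) :
  irreducible_mx T <-> pattern_irreducible T.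
Proof.
rewrite /irreducible_mx irreducible_opP; split=> irrT J JT.
  move=> i j iJ; pose K := [set a : 'I_n * 'I_1 | a.1 \in J]%SET.
  have KT x : band (R := R) K x -> band K (T *m x).
    move=> xK k l; rewrite inE /= => kJ; rewrite mxE big1// => q _.
    have [qJ|qJ] := boolP (q \in J); first by rewrite (JT k q)// mul0r.
    by rewrite xK ?mulr0// inE.
  by have := irrT K KT (i, ord0) (j, ord0); rewrite !inE; apply.
move=> [i i0] [j j0]; rewrite !ord1 => iJ.
pose K := [set i : 'I_n | (i, ord0) \in J]%SET.
suff KT : stable T K by have := irrT K KT i j; rewrite !inE; apply.
move=> k q; rewrite !inE => /(delta_band R J _ _) /JT qJ /qJ.
by rewrite -colE mxE.
Qed.

Lemma wedge_irreducibleP (R : realType) n (T : 'M[R[i]]_n) :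
  irreducible_op (wedge T) <->
  forall J, wedge_stable T J -> forall a b, a \in J -> b \in J.
Proof.
rewrite irreducible_opP; split=> irrT J JT; apply: irrT.
  move=> S SJ i l ilJ; rewrite mxE big1// => k _.
  rewrite mxE big_distrl big1//= => j _.
  have [jkJ|jkJ] := boolP ((j, k) \in J); last by rewrite SJ// mulr0 mul0r.
  by rewrite mulrAC JT ?mul0r.
move=> i j k l /(delta_band R J _ _) /JT jkJ /jkJ.
rewrite /wedge -(mul_delta_mx (ord0 : 'I_1)) mulmxA -mulmxA -colE -rowE.
by rewrite mxE big_ord1 !mxE.
Qed.

(** * Walks in the graph of a nonnegative matrix *)

Section NonnegativeMatrices.
Variable F : numDomainType.

Lemma mulmx_ge0 m n p (A : 'M[F]_(m, n)) (B : 'M[F]_(n, p)) :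
  (forall i j, 0 <= A i j) -> (forall i j, 0 <= B i j) ->
  forall i j, 0 <= (A *m B) i j.
Proof.
by move=> A0 B0 i j; rewrite mxE sumr_ge0// => k _; rewrite mulr_ge0.
Qed.

Lemma mulmx_gt0P m n p (A : 'M[F]_(m, n)) (B : 'M[F]_(n, p)) :
  (forall i j, 0 <= A i j) -> (forall i j, 0 <= B i j) ->
  forall i j, 0 < (A *m B) i j <-> exists k, 0 < A i k /\ 0 < B k j.
Proof.
move=> A0 B0 i j; have AB0 k : true -> 0 <= A i k * B k j by rewrite mulr_ge0.
split=> [|[k [Aik Bkj]]]; last first.
  rewrite mxE (bigD1 k)//= ltr_pwDl ?mulr_gt0// sumr_ge0// => l _.
  exact: mulr_ge0.
rewrite lt0r mxE psumr_neq0// => /andP[/hasP[k _ /= ABk] _]; exists k.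
have : A i k * B k j != 0 by rewrite gt_eqF.
by rewrite mulf_eq0 negb_or !lt0r A0 B0 !andbT => /andP.
Qed.

Variable n : nat.
Implicit Type A : 'M[F]_n.

Lemma expmx_ge0 A : (forall i j, 0 <= A i j) ->
  forall k i j, 0 <= (A ^+ k) i j.
Proof.
move=> A0; elim=> [|k IH] i j; first by rewrite expr0 mxE ler0n.
by rewrite exprS -mulmxE mulmx_ge0.
Qed.

Lemma expmxD_gt0 A k l i j q : (forall i j, 0 <= A i j) ->
  0 < (A ^+ k) i j -> 0 < (A ^+ l) j q -> 0 < (A ^+ (k + l)) i q.
Proof.
move=> A0 Ak Al; rewrite exprD -mulmxE.
by apply/mulmx_gt0P; [exact: expmx_ge0..|exists j].
Qed.

Lemma trmx_exp A k : (A ^+ k)^T = A^T ^+ k.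
Proof.
elim: k => [|k IH]; first by rewrite !expr0 trmx1.
by rewrite exprS exprSr -!mulmxE trmx_mul IH.
Qed.

End NonnegativeMatrices.

Lemma expmx_row (F : pzRingType) n (A : 'M[F]_n) (r : F) (u : 'rV_n) k :
  u *m A = r *: u -> u *m A ^+ k = r ^+ k *: u.
Proof.
move=> uA; elim: k => [|k IH]; first by rewrite !expr0 mulmx1 scale1r.
by rewrite exprSr exprS -mulmxE mulmxA IH -scalemxAl uA scalerA -exprSr exprS.
Qed.

Lemma stable_trmx (F : nmodType) n (A : 'M[F]_n) (J : {set 'I_n}) :
  stable A^T J -> stable A (~: J)%SET.
Proof.
move=> AJ i j; rewrite !inE negbK => jJ iJ.
by rewrite -[RHS](AJ j i) ?mxE.
Qed.

Lemma pattern_irreducible_trmx (F : nmodType) n (A : 'M[F]_n) :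
  pattern_irreducible A -> pattern_irreducible A^T.
Proof.
move=> irrA J /stable_trmx AJ i j iJ; apply/negPn/negP => jJ.
by have := irrA _ AJ j i; rewrite !inE jJ iJ => /(_ isT).
Qed.

Section IrreducibleWalks.
Variables (F : numDomainType) (n : nat) (A : 'M[F]_n).
Hypothesis A0 : forall i j, 0 <= A i j.
Hypothesis irrA : pattern_irreducible A.

(** The coordinates reached by walks from [i] form an invariant set. *)
Lemma irreducible_walk i j : exists k, 0 < (A ^+ k) j i.
Proof.
pose J := [set j | `[< exists k, 0 < (A ^+ k) j i >]]%SET.
have JP q : reflect (exists k, 0 < (A ^+ k) q i) (q \in J).
  by rewrite inE; exact: asboolP.
apply/JP/(@irrA J _ i); last first.
  by apply/JP; exists 0%N; rewrite expr0 mxE eqxx ltr01.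
move=> p q /JP[k kq] /JP pJ.
apply/eqP/negPn/negP => Apq; apply: pJ; exists k.+1.
by rewrite -add1n (expmxD_gt0 (j := q))// expr1 lt0r Apq A0.
Qed.

(** An edge leaving [i] extends to a loop, by a walk back to [i]. *)
Lemma irreducible_loop i : (exists j, 0 < A j i) ->
  exists2 k, (0 < k)%N & 0 < (A ^+ k) i i.
Proof.
move=> [j Aji]; have [k kij] := irreducible_walk j i.
by exists (k + 1)%N; rewrite ?addn1// -addn1 (expmxD_gt0 (j := j))// expr1.
Qed.

(** With a loop at [i] one may wait at [i] before walking to [j], so that all
    sufficiently large lengths are possible, for all [j] together. *)
Lemma loop_walks i : 0 < A i i ->
  exists N, forall M, (N <= M)%N -> forall j, 0 < (A ^+ M) j i.
Proof.
move=> Aii; have loop d : 0 < (A ^+ d) i i.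
  elim: d => [|d IH]; first by rewrite expr0 mxE eqxx ltr01.
  by rewrite -addn1 (expmxD_gt0 (j := i))// expr1.
have /fin_all_exists[k kP] := irreducible_walk i.
exists (\max_j k j) => M NM j.
rewrite -(subnKC (leq_trans (leq_bigmax j) NM)).
exact: expmxD_gt0 (kP j) (loop _).
Qed.

End IrreducibleWalks.

(** A walk from [j] to [i] and a walk from [l] to [k] of the same length [m]
    take the pair [(j, k)] to [(i, l)] in [m] moves, the second walk being
    traversed backwards; an invariant set cannot be left on the way. *)
Lemma wedge_stable_exp (F : numDomainType) n (A : 'M[F]_n) J m :
  (forall i j, 0 <= A i j) -> wedge_stable A J -> wedge_stable (A ^+ m) J.
Proof.
move=> A0 AJ; elim: m => [|m IH] i j k l jkJ ilJ.
  rewrite expr0 !mxE -natrM mulnb; case: andP => // -[/eqP ij /eqP kl].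
  by rewrite ij -kl jkJ in ilJ.
apply/eqP/negPn/negP; rewrite mulf_eq0 negb_or => /andP[Aij Akl].
have Am := expmx_ge0 A0 m.
have pos p q : (A ^+ m.+1) p q != 0 -> 0 < (A ^+ m.+1) p q.
  by rewrite lt0r expmx_ge0// andbT.
have := pos _ _ Aij; rewrite exprS -mulmxE => /(mulmx_gt0P A0 Am)[p [Aip Apj]].
have := pos _ _ Akl; rewrite exprSr -mulmxE => /(mulmx_gt0P Am A0)[q [Akq Aql]].
have [pqJ|pqJ] := boolP ((p, q) \in J).
  by have /eqP := AJ _ _ _ _ pqJ ilJ; rewrite gt_eqF// mulr_gt0.
by have /eqP := IH _ _ _ _ jkJ pqJ; rewrite gt_eqF// mulr_gt0.
Qed.

(** Given a loop of length [a] at [j] and one of length [b] at [k], the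
    irreducibility of [A ^+ a] and of [A ^+ b] gives walks from [j] to any [i]
    and from any [l] to [k] of any large length that is a multiple of both [a]
    and [b]. *)
Lemma powers_irreducible_wedge (F : numDomainType) n (A : 'M[F]_n) :
  (forall i j, 0 <= A i j) ->
  (forall m, (0 < m)%N -> pattern_irreducible (A ^+ m)) ->
  (forall j, exists i, 0 < A i j) ->
  forall J, wedge_stable A J -> forall a b, a \in J -> b \in J.
Proof.
move=> A0 irrA Acol J AJ [j k] [i l] jkJ; apply/negPn/negP => ilJ.
have irr1 : pattern_irreducible A by have := irrA 1%N isT; rewrite expr1.
have [a a0 aj] := irreducible_loop A0 irr1 (Acol j).
have [b b0 bk] := irreducible_loop A0 irr1 (Acol k).
have [M MP] := loop_walks (expmx_ge0 A0 a) (irrA a a0) aj.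
have Ab0 p q : 0 <= ((A ^+ b)^T) p q by rewrite mxE expmx_ge0.
have [|N NP] := loop_walks Ab0 (pattern_irreducible_trmx (irrA b b0)) (i := k).
  by rewrite mxE.
pose m := (a * b * (M + N))%N.
have mij : 0 < (A ^+ m) i j.
  rewrite /m -mulnA exprM MP// (leq_trans (leq_addr N M))//.
  by rewrite leq_pmull.
have mkl : 0 < (A ^+ m) k l.
  rewrite /m mulnAC mulnC exprM -[_ ^+ _]trmxK trmx_exp mxE NP//.
  by rewrite (leq_trans (leq_addl M N))// leq_pmull.
have /eqP := wedge_stable_exp m A0 AJ jkJ ilJ.
by rewrite gt_eqF// mulr_gt0.
Qed.

(** * Perron eigenvectors *)

(** Any two coordinates are joined by a walk; [P] is a sum of powers of [A]
    covering all the lengths needed. *)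
Lemma irreducible_smoothing (F : numDomainType) n (A : 'M[F]_n) :
  (forall i j, 0 <= A i j) -> pattern_irreducible A ->
  exists2 P : 'M[F]_n, P *m A = A *m P & forall i j, 0 < P i j.
Proof.
move=> A0 irrA.
have walk (p : 'I_n * 'I_n) : exists k, 0 < (A ^+ k) p.1 p.2.
  exact: irreducible_walk.
have {walk}/fin_all_exists[k kP] := walk.
exists (\sum_p A ^+ k p) => [|i j].
  rewrite mulmx_suml mulmx_sumr; apply: eq_bigr => p _.
  by rewrite !mulmxE -exprS -exprSr.
rewrite summxE (bigD1 (i, j))//= ltr_pwDl ?(kP (i, j))//.
by rewrite sumr_ge0// => p _; exact: expmx_ge0.
Qed.

Lemma closed_le_continuous (R : realType) (T : topologicalType) (f g : T -> R) :
  continuous f -> continuous g -> closed [set p | f p <= g p].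
Proof.
move=> cf cg.
rewrite (_ : mkset _ = (fun p => g p - f p) @^-1` [set y | 0 <= y]); last first.
  by apply/seteqP; split=> p /=; rewrite subr_ge0.
apply: preimage_closed; last exact: closed_ge.
by move=> p _; apply: cvgB; [exact: cg|exact: cf].
Qed.

Section CollatzWielandt.
Variables (R : realType) (n : nat) (A : 'M[R]_n.+1).
Hypothesis A0 : forall i j, 0 <= A i j.

(** The pairs [(t, x)] with [x] in the unit simplex and [t x <= x A]; the
    largest [t] occurring here is the Perron eigenvalue. *)
Definition subeigenpairs : set (R * 'rV[R]_n.+1) :=
  [set p : R * 'rV[R]_n.+1 |
    [/\ 0 <= p.1, forall j, 0 <= p.2 ord0 j, \sum_j p.2 ord0 j = 1 &
               forall j, p.1 * p.2 ord0 j <= (p.2 *m A) ord0 j]].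

Lemma subeigenpairs_closed : closed subeigenpairs.
Proof.
have c1 : continuous (fun p : R * 'rV[R]_n.+1 => p.1).
  by move=> p; exact: cvg_fst.
have c2 j : continuous (fun p : R * 'rV[R]_n.+1 => p.2 ord0 j).
  move=> p; apply: (@cvg_comp _ _ _ snd (fun x : 'rV_n.+1 => x ord0 j)).
    exact: cvg_snd.
  exact: coord_continuous.
have csum (c : 'I_n.+1 -> R) :
    continuous (fun p : R * 'rV[R]_n.+1 => \sum_j p.2 ord0 j * c j).
  move=> p; apply: cvg_big => [|j _]; first exact: add_continuous.
  by apply: cvgM; [exact: c2|exact: cvg_cst].
have c0 (c : R) : continuous (fun p : R * 'rV[R]_n.+1 => c).
  by move=> p; exact: cvg_cst.
pose E := (R * 'rV[R]_n.+1)%type.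
rewrite (_ : subeigenpairs = [set p : E | 0 <= p.1] `&`
  (\bigcap_j [set p : E | 0 <= p.2 ord0 j]) `&`
  ([set p : E | \sum_j p.2 ord0 j * 1 <= 1] `&`
   [set p : E | 1 <= \sum_j p.2 ord0 j * 1]) `&`
  (\bigcap_j [set p : E | p.1 * p.2 ord0 j <= \sum_i p.2 ord0 i * A i j])).
  apply: closedI; last first.
    apply: closed_bigI => j _; apply: closed_le_continuous; last exact: csum.
    by move=> p; apply: cvgM; [exact: c1|exact: c2].
  apply: closedI; first apply: closedI.
  - exact: closed_le_continuous.
  - by apply: closed_bigI => j _; exact: closed_le_continuous.
  - by apply: closedI; apply: closed_le_continuous => //; exact: csum.
apply/seteqP; split=> -[t x] /=.
  move=> [t0 x0 x1 tx]; split; last by move=> j _ /=; have := tx j; rewrite mxE.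
  split; first by split=> // j _; exact: x0.
  by under eq_bigr do rewrite mulr1; rewrite x1.
move=> [[[t0 x0] [/=]]]; under eq_bigr do rewrite mulr1.
move=> x1 x1' tx; split=> // [j||j]; first exact: x0.
  by apply/eqP; rewrite eq_le x1 x1'.
by rewrite mxE; exact: tx.
Qed.

Lemma subeigenpairs_compact : compact subeigenpairs.
Proof.
pose M := \sum_j \sum_i A i j.
apply: (subclosed_compact subeigenpairs_closed
  (B := `[0, M] `*`
        [set v : 'rV[R]_n.+1 | forall i, `[0, 1]%classic (v ord0 i)])).
  apply: compact_setX; first exact: segment_compact.
  have := @rV_compact R n.+1 (fun=> `[(0 : R), 1]%classic).
  by apply => _; exact: segment_compact.
move=> [t x] [/= t0 x0 x1 tx].
have x_le1 i : x ord0 i <= 1.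
  by rewrite -x1 (bigD1 i)//= lerDl sumr_ge0.
split=> /= [|i]; rewrite in_itv/= ?x0 ?x_le1// t0/=.
rewrite -[t]mulr1 -x1 mulr_sumr ler_sum// => j _; apply: le_trans (tx j) _.
by rewrite mxE ler_sum// => i _; rewrite ler_piMl.
Qed.

Lemma subeigenpairs_max :
  exists2 p, subeigenpairs p & forall q, subeigenpairs q -> q.1 <= p.1.
Proof.
have K0 : subeigenpairs !=set0.
  exists (0, delta_mx ord0 ord0); split=> //= [j||j].
    by rewrite mxE ler0n.
    rewrite (bigD1 ord0)//= big1 ?mxE ?addr0// => j /negPf j0.
    by rewrite mxE j0 andbF.
  by rewrite mul0r mulmx_ge0// => i k; rewrite mxE ler0n.
have cK : {within subeigenpairs, continuous (fun p : R * 'rV[R]_n.+1 => p.1)}.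
  by apply: continuous_subspaceT => p; exact: cvg_fst.
have [p pK pmax] := compact_EVT_max K0 subeigenpairs_compact cK.
by exists p => [|q qK]; [exact: set_mem|apply/pmax/mem_set].
Qed.

(** Let [(t, x)] maximize [t]. A positive matrix [P] commuting with [A] turns
    [x] into a positive vector [u] with [u A - t u = (x A - t x) P]. Were
    [x A - t x] nonzero, the right-hand side would be positive in all
    coordinates, leaving room for a larger [t]. *)
Lemma perron_row : pattern_irreducible A ->
  exists r (u : 'rV[R]_n.+1), [/\ 0 <= r, forall j, 0 < u ord0 j &
    u *m A = r *: u].
Proof.
move=> /(irreducible_smoothing A0)[P PA P0].
have [[t x] /= [t0 x0 x1 tx] tmax] := subeigenpairs_max.
have posP (y : 'rV[R]_n.+1) : (forall j, 0 <= y ord0 j) -> y != 0 ->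
    forall j, 0 < (y *m P) ord0 j.
  move=> y0 yn0 j; apply/mulmx_gt0P => [i k||]; rewrite ?ord1//.
    by move=> i k; exact: ltW.
  by have /rV0Pn[k yk] := yn0; exists k; rewrite lt0r yk y0.
have u0 : forall j, 0 < (x *m P) ord0 j.
  apply: posP => //; apply: contra_eq_neq x1 => ->.
  by rewrite big1 => [|j _]; rewrite ?mxE// eq_sym oner_neq0.
exists t, (x *m P); split=> //; apply/eqP; rewrite -subr_eq0.
have -> : x *m P *m A - t *: (x *m P) = (x *m A - t *: x) *m P.
  by rewrite mulmxBl -!mulmxA PA scalemxAl.
have [->|/posP d0] := eqVneq (x *m A - t *: x) 0; first by rewrite mul0mx.
set u := x *m P in u0 *.
have {d0} tu j : t * u ord0 j < (u *m A) ord0 j.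
  rewrite -subr_gt0; have -> : (u *m A) ord0 j - t * u ord0 j =
      ((x *m A - t *: x) *m P) ord0 j.
    by rewrite mulmxBl -!mulmxA -PA !mulmxA -scalemxAl -/u !mxE.
  by apply: d0 => k; rewrite !mxE subr_ge0; have := tx k; rewrite mxE.
(* The least ratio [s j0] exceeds [t], and [u], once normalized, realizes it. *)
pose s j := (u *m A) ord0 j / u ord0 j.
pose j0 := [arg min_(j < ord0) s j]%O.
have s_min j : s j0 <= s j.
  by rewrite /j0; case: Order.TotalTheory.arg_minP => // i _; apply.
have ts : t < s j0 by rewrite ltr_pdivlMr.
have sum_gt0 : 0 < \sum_j u ord0 j.
  by rewrite (bigD1 ord0)//= ltr_pwDl// sumr_ge0// => j _; exact: ltW.
suff /tmax : subeigenpairs (s j0, (\sum_j u ord0 j)^-1 *: u).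
  by rewrite leNgt ts.
split=> /= [|j||j].
- exact: le_trans t0 (ltW ts).
- by rewrite mxE mulr_ge0// ?invr_ge0 ltW.
- under eq_bigr do rewrite mxE.
  by rewrite -mulr_sumr mulVf// gt_eqF.
- rewrite -scalemxAl [X in s j0 * X]mxE [leRHS]mxE mulrCA.
  rewrite ler_wpM2l ?invr_ge0 ?(ltW sum_gt0)// -ler_pdivlMr; last exact: u0.
  exact: s_min.
Qed.
End CollatzWielandt.

(** * Eigenvalues on the circle of radius the Perron eigenvalue *)

(** A positive column [v] makes [w |-> w *m v] strictly monotone on rows. *)
Lemma eq_row_pairing (F : numDomainType) n (v : 'cV[F]_n) (w1 w2 : 'rV[F]_n) :
  (forall i, 0 < v i ord0) -> (forall j, w1 ord0 j <= w2 ord0 j) ->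
  w1 *m v = w2 *m v -> w1 = w2.
Proof.
move=> v0 w12 /matrixP/(_ ord0 ord0)/eqP; rewrite eq_sym -subr_eq0 !mxE.
rewrite -sumrB; under eq_bigr do rewrite -mulrBl.
rewrite psumr_eq0 => [/allP w0|j _]; last first.
  by rewrite mulr_ge0 ?subr_ge0 ?(ltW (v0 j)).
apply/rowP => j; apply/esym/eqP; rewrite -subr_eq0.
by have := w0 j (mem_index_enum _); rewrite /= mulf_eq0 (gt_eqF (v0 j)) orbF.
Qed.

Section Modulus.
Variables (C : numClosedFieldType) (n : nat) (T : 'M[C]_n.+1).
Hypothesis T0 : forall i j, 0 <= T i j.
Variables (r : C) (v : 'cV[C]_n.+1).
Hypothesis v0 : forall i, 0 < v i ord0.
Hypothesis Tv : T *m v = r *: v.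
Variables (a : C) (z : 'rV[C]_n.+1).
Hypothesis zT : z *m T = a *: z.

Let absz := map_mx (@Num.norm C C) z.

(** Pairing this triangle inequality with the positive eigenvector [v] gives
    both the bound on [`|a|] and, when [`|a| = r], the equality
    [|z| T = r |z|]. *)
Let absz_sub j : `|a| * absz ord0 j <= (absz *m T) ord0 j.
Proof.
rewrite [absz _ _]mxE -normrM.
have -> : a * z ord0 j = (z *m T) ord0 j by rewrite zT mxE.
rewrite !mxE (le_trans (ler_norm_sum _ _ _))// ler_sum// => i _.
by rewrite normrM (ger0_norm (T0 i j)) mxE.
Qed.

Let pairing : (absz *m T) *m v = r *: (absz *m v).
Proof. by rewrite -mulmxA Tv scalemxAr. Qed.

Lemma eigenvalue_norm_le : z != 0 -> `|a| <= r.
Proof.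
move=> zn0; have zv0 : 0 < (absz *m v) ord0 ord0.
  have /rV0Pn[k zk] := zn0.
  rewrite mxE (bigD1 k)//= ltr_pwDl//.
    by rewrite mulr_gt0// mxE normr_gt0.
  by rewrite sumr_ge0// => i _; rewrite mulr_ge0 ?(ltW (v0 i))// mxE.
rewrite -(ler_pM2r zv0).
have -> : r * (absz *m v) ord0 ord0 = (absz *m T *m v) ord0 ord0.
  by rewrite pairing [RHS]mxE.
rewrite [(absz *m v) _ _]mxE [(_ *m v) _ _]mxE mulr_sumr ler_sum// => j _.
by rewrite mulrA ler_wpM2r// ltW.
Qed.

Lemma peripheral_abs_eigenvector : `|a| = r -> absz *m T = r *: absz.
Proof.
move=> ar; apply/esym/(eq_row_pairing v0); last by rewrite pairing scalemxAl.
by move=> j; have := absz_sub j; rewrite ar [X in _ -> X <= _]mxE.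
Qed.

End Modulus.

Lemma eigenvalue_unitmxN (F : fieldType) n (T : 'M[F]_n) a :
  a%:M - T \notin unitmx <-> exists2 z : 'rV_n, z *m T = a *: z & z != 0.
Proof.
rewrite -row_free_unit -kermx_eq0; split=> [/rowV0Pn[z /sub_kermxP]|[z zT zn0]].
  rewrite mulmxBr mul_mx_scalar => /eqP; rewrite subr_eq0 => /eqP zT zn0.
  by exists z.
apply/rowV0Pn; exists z => //; apply/sub_kermxP.
by rewrite mulmxBr mul_mx_scalar zT subrr.
Qed.

Section OnlyPeripheralEigenvalue.
Variables (C : numClosedFieldType) (n : nat) (T : 'M[C]_n.+1) (r : C).
Hypothesis r_gt0 : 0 < r.
Hypothesis prim : forall a (z : 'rV[C]_n.+1),
  z *m T = a *: z -> z != 0 -> `|a| = r -> a = r.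

(** Write ['X^m - r ^+ m = ('X - r) Q]. The roots of [Q] have modulus [r] and
    differ from [r], since [Q.[r] = m r ^+ m.-1]; so none of them is an
    eigenvalue, [Q] is invertible at [T], and [w (T - r) Q(T) = 0] forces
    [w (T - r) = 0]. *)
Lemma eigenvector_of_power m (w : 'rV[C]_n.+1) : (0 < m)%N ->
  w *m T ^+ m = r ^+ m *: w -> w *m T = r *: w.
Proof.
move=> m0 wTm.
pose Q := \sum_(i < m) 'X ^+ (m.-1 - i) * (r%:P : {poly C}) ^+ i.
have QE : 'X^m - (r ^+ m)%:P = ('X - r%:P) * Q.
  by rewrite polyC_exp subrXX.
have Qr : Q.[r] != 0.
  rewrite horner_sum (eq_bigr (fun=> r ^+ m.-1)) => [|i _].
    rewrite sumr_const card_ord -mulr_natl mulf_neq0 ?expf_neq0 ?gt_eqF//.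
    by rewrite ltr0n.
  rewrite hornerM !horner_exp hornerX hornerC -exprD subnK//.
  by rewrite -ltnS prednK.
have Qn0 : Q != 0 by apply: contraNneq Qr => ->; rewrite horner0.
have Qroot a : root Q a -> a%:M - T \in unitmx.
  move=> Qa; apply/negPn/negP => /eigenvalue_unitmxN[z zT zn0].
  suff ar : a = r by rewrite ar (rootE Q r) (negPf Qr) in Qa.
  apply: prim zT zn0 _; apply/eqP.
  rewrite -(eqrXn2 m0 (normr_ge0 a) (ltW r_gt0)) -normrX.
  have : ('X^m - (r ^+ m)%:P).[a] = 0 by rewrite QE hornerM (rootP Qa) mulr0.
  rewrite !hornerE => /eqP; rewrite subr_eq0 => /eqP ->.
  by rewrite ger0_norm// exprn_ge0// ltW.
have QT : horner_mx T Q \in unitmx.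
  have [rs Qrs] := closed_field_poly_normal Q.
  rewrite Qrs linearZ/= rmorph_prod/= unitmxZ ?unitfE ?lead_coef_eq0//.
  apply: (@unitr_prod_in 'M[C]_n.+1) => a ars _.
  rewrite rmorphB/= horner_mx_X horner_mx_C -unitrN opprB; apply: Qroot.
  by rewrite Qrs rootZ ?lead_coef_eq0// root_prod_XsubC.
have : w *m (T - r%:M) *m horner_mx T Q = 0.
  have -> : T - r%:M = horner_mx T ('X - r%:P).
    by rewrite rmorphB/= horner_mx_X horner_mx_C.
  rewrite -mulmxA mulmxE -rmorphM -QE rmorphB/= rmorphXn/= horner_mx_X.
  by rewrite horner_mx_C mulmxBr wTm mul_mx_scalar subrr.
move=> /(congr1 (mulmx^~ (invmx (horner_mx T Q)))); rewrite mulmxK// mul0mx.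
by move/eqP; rewrite mulmxBr mul_mx_scalar subr_eq0 => /eqP.
Qed.

Hypothesis T0 : forall i j, 0 <= T i j.
Hypothesis irrT : pattern_irreducible T.
Variables (u : 'rV[C]_n.+1) (v : 'cV[C]_n.+1).
Hypothesis u0 : forall j, 0 < u ord0 j.
Hypothesis v0 : forall i, 0 < v i ord0.
Hypothesis uT : u *m T = r *: u.
Hypothesis Tv : T *m v = r *: v.

Lemma expmx_col m : T ^+ m *m v = r ^+ m *: v.
Proof.
apply: trmx_inj; rewrite linearZ/= trmx_mul trmx_exp; apply: expmx_row.
by rewrite -trmx_mul Tv linearZ.
Qed.

(** If [J] is invariant under [T ^+ m], the restriction [w] of the left Perron
    eigenvector [u] to the complement of [J] satisfies [w T^m <= r^m w], hence
    [w T^m = r^m w] by pairing with [v]. Then [w] is already an eigenvector of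
    [T], so that [J] is invariant under [T]. *)
Lemma primitive_powers_irreducible m : (0 < m)%N ->
  pattern_irreducible (T ^+ m).
Proof.
move=> m0 J JTm; apply: irrT => p q qJ pJ.
have Tm0 := expmx_ge0 T0 m.
pose w := \row_i (if i \in J then 0 else u ord0 i).
have wle i : 0 <= w ord0 i <= u ord0 i.
  by rewrite mxE; case: ifP; rewrite lexx (ltW (u0 _)).
have wTm : w *m T ^+ m = r ^+ m *: w.
  apply: (eq_row_pairing v0) => [j|]; last first.
    by rewrite -mulmxA expmx_col -scalemxAr scalemxAl.
  have [jJ|jJ] := boolP (j \in J).
    rewrite [leRHS]mxE [w _ _]mxE jJ mulr0 mxE big1// => i _.
    rewrite mxE; case: ifP => [_|iJ]; first by rewrite mul0r.
    by rewrite JTm ?mulr0// iJ.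
  rewrite [leRHS]mxE [w _ _]mxE (negPf jJ).
  have -> : r ^+ m * u ord0 j = (u *m T ^+ m) ord0 j.
    by rewrite (expmx_row _ uT) mxE.
  by rewrite !mxE ler_sum// => i _; rewrite ler_wpM2r//; case/andP: (wle i).
have /matrixP/(_ ord0 q) := eigenvector_of_power m0 wTm.
rewrite !mxE qJ mulr0 => /eqP; rewrite psumr_eq0 => [/allP wT|i _]; last first.
  by rewrite mulr_ge0//; case/andP: (wle i).
have := wT p (mem_index_enum _); rewrite mxE (negPf pJ) mulf_eq0.
by rewrite (gt_eqF (u0 p)) => /eqP.
Qed.

End OnlyPeripheralEigenvalue.

Section WedgeIrreducible.
Variables (C : numClosedFieldType) (n : nat) (T : 'M[C]_n.+1) (r : C).
Hypothesis T0 : forall i j, 0 <= T i j.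
Hypothesis irrT : pattern_irreducible T.
Hypothesis wedgeT :
  forall J, wedge_stable T J -> forall a b, a \in J -> b \in J.
Hypothesis r_gt0 : 0 < r.
Variable v : 'cV[C]_n.+1.
Hypothesis v0 : forall i, 0 < v i ord0.
Hypothesis Tv : T *m v = r *: v.

(** Let [z T = a z] with [`|a| = r]. Equality in the triangle inequality for
    [`|a z j| = `|\sum_i z i * T i j|] makes the phases [e i = z i / `|z i|]
    satisfy [r e i = a e j] whenever [T i j != 0]. A step of the wedge graph
    multiplies one phase by [r / a] and the other by [a / r], so it preserves
    the product [e j * e k]; being connected, that graph makes all phases equal,
    whence [a = r]. *)
Lemma wedge_irreducible_peripheral a (z : 'rV[C]_n.+1) :
  z *m T = a *: z -> z != 0 -> `|a| = r -> a = r.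
Proof.
move=> zT zn0 ar; have absT := peripheral_abs_eigenvector T0 v0 Tv zT ar.
have an0 : a != 0 by rewrite -normr_gt0 ar.
have absTE j : \sum_i `|z ord0 i| * T i j = r * `|z ord0 j|.
  have /matrixP/(_ ord0 j) := absT; rewrite !mxE => <-.
  by apply: eq_bigr => i _; rewrite mxE.
have z0 j : z ord0 j != 0.
  apply: contra_neqN zn0 => zj; apply/rowP => k; rewrite mxE.
  pose J := [set i | z ord0 i == 0]%SET.
  suff JT : stable T J.
    by have := @irrT J JT j k; rewrite !inE => /(_ zj)/eqP.
  move=> p q; rewrite !inE => /eqP zq zp.
  have /eqP := absTE q; rewrite zq normr0 mulr0 psumr_eq0 => [/allP H|i _].
    have /= := H p (mem_index_enum _).
    by rewrite mulf_eq0 normr_eq0 (negPf zp) => /eqP.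
  by rewrite mulr_ge0.
pose e j := z ord0 j / `|z ord0 j|.
have en0 j : e j != 0 by rewrite mulf_neq0 ?invr_eq0 ?normr_eq0.
have phase i j : T i j != 0 -> r * e i = a * e j.
  move=> Tij.
  have zTj : \sum_i z ord0 i * T i j = a * z ord0 j.
    by have /matrixP/(_ ord0 j) := zT; rewrite !mxE.
  have [|t _ zt] := @normC_sum_eq C _ xpredT (fun i => z ord0 i * T i j).
    rewrite zTj normrM ar -absTE; apply: eq_bigr => k _.
    by rewrite normrM (ger0_norm (T0 k j)).
  have ei : e i = t.
    have := zt i isT; rewrite normrM (ger0_norm (T0 i j)) mulrAC.
    move=> /(mulIf Tij) zi.
    by rewrite /e [X in X / _]zi mulrAC mulfV ?mul1r// normr_eq0.
  have : a * z ord0 j = r * `|z ord0 j| * t.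
    rewrite -zTj -absTE mulr_suml; apply: eq_bigr => k _.
    by rewrite zt// normrM (ger0_norm (T0 k j)).
  by rewrite ei /e mulrA => ->; rewrite mulrAC mulfK// normr_eq0.
pose J := [set p : 'I_n.+1 * 'I_n.+1 | e p.1 * e p.2 == e ord0 * e ord0]%SET.
have JT : wedge_stable T J.
  move=> i j k l; rewrite !inE /= => /eqP jk il.
  apply/eqP/negPn/negP; rewrite mulf_eq0 negb_or => /andP[/phase ij /phase kl].
  move/negP: il; apply; rewrite -jk; apply/eqP.
  apply: (mulfI (lt0r_neq0 r_gt0)); rewrite mulrA ij.
  by rewrite [RHS]mulrCA kl [RHS]mulrCA mulrA.
have ee j : e j = e ord0.
  have := @wedgeT J JT (ord0, ord0) (j, ord0); rewrite !inE eqxx /=.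
  by move=> /(_ isT)/eqP/(mulIf (en0 _)).
have [i Ti] : exists i, T i ord0 != 0.
  apply/existsP; apply: contraT => /existsPn Tz.
  have /eqP := absTE ord0; rewrite big1 => [|i _].
    by rewrite eq_sym mulf_eq0 normr_eq0 (negPf (z0 _)) orbF gt_eqF.
  by have /negPn/eqP -> := Tz i; rewrite mulr0.
by have := phase _ _ Ti; rewrite (ee i) => /(mulIf (en0 _)).
Qed.

End WedgeIrreducible.

(** * The spectral radius of an irreducible positive matrix *)

(** The left and right Perron eigenvalues agree: [u A v] is both of them times
    [u v > 0]. *)
Lemma perron_pair (R : realType) n (T : 'M[R[i]]_n.+1) :
  positive_mx T -> pattern_irreducible T ->
  exists (r : R) (u : 'rV[R[i]]_n.+1) (v : 'cV[R[i]]_n.+1),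
    [/\ 0 <= r, forall j, 0 < u ord0 j, forall i, 0 < v i ord0,
        u *m T = r%:C%C *: u & T *m v = r%:C%C *: v].
Proof.
move=> T0 irrT; pose A := map_mx (@complex.Re R) T.
have TA : T = map_mx (real_complex R) A.
  by apply/matrixP => i j; rewrite !mxE RRe_real// ger0_real.
have A0 i j : 0 <= A i j by rewrite -ler0c; have := T0 i j; rewrite TA mxE.
have irrA : pattern_irreducible A.
  by move=> J AJ; apply: irrT => i j iJ jJ; rewrite TA mxE (AJ i j).
have [r [u [r0 u0 uA]]] := perron_row A0 irrA.
have At0 i j : 0 <= A^T i j by rewrite mxE.
have [s [v [s0 v0 vA]]] := perron_row At0 (pattern_irreducible_trmx irrA).
have Av : A *m v^T = s *: v^T by rewrite -[A]trmxK -trmx_mul vA linearZ.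
have rs : r = s.
  have uv0 : (u *m v^T) ord0 ord0 != 0.
    rewrite gt_eqF// mxE (bigD1 ord0)//= ltr_pwDl//.
      by rewrite mxE mulr_gt0.
    by rewrite sumr_ge0// => i _; rewrite mxE mulr_ge0// ltW.
  apply: (mulIf uv0); have : u *m A *m v^T = u *m (A *m v^T) by rewrite mulmxA.
  rewrite uA Av -scalemxAl -scalemxAr => /matrixP/(_ ord0 ord0).
  by rewrite !mxE.
exists r, (map_mx (real_complex R) u), (map_mx (real_complex R) v^T).
split=> //.
- by move=> j; rewrite mxE ltcR.
- by move=> i; rewrite !mxE ltcR.
- by rewrite TA -map_mxM uA map_mxZ.
- by rewrite TA -map_mxM Av -rs map_mxZ.
Qed.

(** A positive column eigenvector bounds all eigenvalues by its own, which is
    an eigenvalue as witnessed by [u]; so the supremum is attained there. *)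
Lemma spectral_radius_perron (R : realType) n (T : 'M[R[i]]_n.+1) (r : R)
    (u : 'rV_n.+1) (v : 'cV_n.+1) :
  positive_mx T -> 0 <= r ->
  (forall j, 0 < u ord0 j) -> (forall i, 0 < v i ord0) ->
  u *m T = r%:C%C *: u -> T *m v = r%:C%C *: v ->
  spectral_radius T = r.
Proof.
move=> T0 r0 u0 v0 uT Tv; pose S := [set normc a | a in spectrum T].
have Sr : S r.
  exists r%:C%C.
    apply/eigenvalue_unitmxN; exists u => //.
    by apply/rV0Pn; exists ord0; rewrite gt_eqF.
  by apply: complexI; rewrite -[LHS]/`|r%:C%C| ger0_norm ?ler0c.
have rS : ubound S r.
  move=> _ [a /eigenvalue_unitmxN[z zT zn0] <-].
  by rewrite -lecR; exact: (eigenvalue_norm_le T0 v0 Tv zT).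
apply/eqP; rewrite eq_le; apply/andP; split.
  by apply: ge_sup rS; exists r.
by apply: ub_le_sup Sr; exists r.
Qed.

(** If [J] is invariant under [T], the matrices whose rows off [J] vanish form
    an invariant band of the wedge operator. *)
Lemma wedge_irreducible_pattern (F : pzRingType) n (T : 'M[F]_n) :
  (forall J, wedge_stable T J -> forall a b, a \in J -> b \in J) ->
  pattern_irreducible T.
Proof.
move=> wT J JT i j iJ; pose K := [set p : 'I_n * 'I_n | p.1 \in J]%SET.
suff KT : wedge_stable T K.
  by have := wT K KT (i, i) (j, j); rewrite !inE; apply.
by move=> p q k l; rewrite !inE /= => qJ pJ; rewrite (JT p q)// mul0r.
Qed.

(** * Irreducibility of the wedge operator *)

Theorem theorem32 (R : realType) (n : nat) (T : 'M[R[i]]_n) :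
  positive_mx T ->
  (irreducible_mx T /\ primitive T) <-> irreducible_op (wedge T).
Proof.
rewrite irreducible_mxP wedge_irreducibleP.
case: n T => [|n] T T0.
  split=> [_ J _ [[]]//|_]; split=> [J _ []//|a b [/eigenvalue_unitmxN[z _]]].
  by move=> /rV0Pn[[]].
have peripheralP (r : R) (u : 'rV_n.+1) (v : 'cV_n.+1) :
    0 <= r -> (forall j, 0 < u ord0 j) ->
    (forall i, 0 < v i ord0) -> u *m T = r%:C%C *: u -> T *m v = r%:C%C *: v ->
  forall a, peripheral_spectrum T a <->
    exists2 z : 'rV_n.+1, z *m T = a *: z & z != 0 /\ `|a| = r%:C%C.
  move=> r0 u0 v0 uT Tv a; have rE := spectral_radius_perron T0 r0 u0 v0 uT Tv.
  rewrite /peripheral_spectrum/= rE; split.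
    by move=> [/eigenvalue_unitmxN[z zT zn0] ar]; exists z; rewrite // -ar.
  move=> [z zT [zn0 ar]]; split; last exact: complexI.
  by apply/eigenvalue_unitmxN; exists z.
split=> [[irrT primT]|wT].
  have [r [u [v [r0 u0 v0 uT Tv]]]] := perron_pair T0 irrT.
  have [r_eq0|rn0] := eqVneq r 0.
    (* Here [T v = 0] forces [T = 0], irreducible only in dimension 1. *)
    have Tz p q : T p q = 0.
      have /matrixP/(_ p ord0) := Tv; rewrite r_eq0 !mxE mul0r => /eqP.
      rewrite psumr_eq0 => [/allP/(_ q (mem_index_enum _))/=|k _].
        by rewrite mulf_eq0 (gt_eqF (v0 q)) orbF => /eqP.
      by rewrite mulr_ge0 ?T0// ltW.
    have one p q : q = p :> 'I_n.+1.
      apply/set1P; apply: (irrT [set p]%SET) (set11 p) => i j _ _; exact: Tz.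
    by move=> J _ [p q] [k l]; rewrite (one p k) (one q l).
  have rC : 0 < (r%:C)%C by rewrite ltcR lt0r rn0.
  apply: (powers_irreducible_wedge T0).
    move=> m m0.
    apply: (primitive_powers_irreducible rC _ T0 irrT u0 v0 uT Tv) => //.
    move=> a z zT zn0 ar; apply: primT; apply/(peripheralP r u v) => //.
      by exists z.
    exists u => //; split; last by rewrite gtr0_norm.
    by apply/rV0Pn; exists ord0; rewrite gt_eqF.
  move=> j; apply: contrapT => noi; have /matrixP/(_ ord0 j)/eqP := uT.
  rewrite !mxE big1 => [|i _]; first by rewrite eq_sym gt_eqF// mulr_gt0.
  have [->|Tij] := eqVneq (T i j) 0; first by rewrite mulr0.
  by case: noi; exists i; rewrite lt0r Tij T0.
have irrT := wedge_irreducible_pattern wT; split=> //.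
have [r [u [v [r0 u0 v0 uT Tv]]]] := perron_pair T0 irrT.
move=> a b /(peripheralP r u v r0 u0 v0 uT Tv)[z zT [zn0 ar]].
move=> /(peripheralP r u v r0 u0 v0 uT Tv)[y yT [yn0 br]].
have [r_eq0|rn0] := eqVneq r 0.
  have /normr0_eq0-> : `|a| = 0 by rewrite ar r_eq0.
  by apply/esym/normr0_eq0; rewrite br r_eq0.
have rC : 0 < (r%:C)%C by rewrite ltcR lt0r rn0.
rewrite (wedge_irreducible_peripheral T0 irrT wT rC v0 Tv zT)//.
by rewrite (wedge_irreducible_peripheral T0 irrT wT rC v0 Tv yT).
Qed.
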